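(* Let $\mathcal{C}$ be the class of all Myerson-regular distributions supported on $[0,1]$. For every sufficiently small $\epsilon>0$, it is possible to describe $\mathcal{C}$ with $b=\tilde{O}(\epsilon^{-1/2})$ bits and error $\epsilon$. Moreover this is tight up to polylogarithmic factors: any description of $\mathcal{C}$ with error $\epsilon$ requires $b=\Omega(\epsilon^{-1/2})$ bits.
   Context: A distribution with CDF $F$ is (Myerson-)regular if its revenue curve in quantile space $R(q)=q\cdot F^{-1}(1-q)$ is concave on $[0,1]$; for distributions with a differentiable PDF $f$ and no point masses this is equivalent to $f'(v)(1-F(v))\ge -2f(v)^2$. The Lévy distance between CDFs $F,G$ is $\mathrm{L\acute{e}vy}(F,G)=\inf\{\epsilon: F(v-\epsilon)-\epsilon\le G(v)\le F(v+\epsilon)+\epsilon\ \forall v\}$. A class of distributions $\mathcal{C}$ can be described with $b$ bits and error $\epsilon$ if there is a class $\mathcal{C}'$ of distributions with $|\mathcal{C}'|\le 2^b$ such that for every $F\in\mathcal{C}$ there is $F'\in\mathcal{C}'$ with $\mathrm{L\acute{e}vy}(F,F')\le\epsilon$. $\tilde{O}(\cdot)$ hides factors polylogarithmic in $1/\epsilon$. *)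

(* Defs.v *)
From HB Require Import structures.
From mathcomp Require Import all_boot all_order all_algebra.
From mathcomp Require Import all_classical all_reals all_analysis.
Set Implicit Arguments. Unset Strict Implicit. Unset Printing Implicit Defensive.
Import Order.TTheory GRing.Theory Num.Theory.
Import numFieldNormedType.Exports.
Local Open Scope classical_set_scope.
Local Open Scope ring_scope.

(* A (real) distribution is represented by its CDF. *)
Definition is_cdf (R : realType) (F : R -> R) : Prop :=
  {homo F : x y / x <= y} /\
  (forall x : R, F y @[y --> x^'+] --> F x) /\
  (F x @[x --> -oo] --> (0 : R)) /\
  (F x @[x --> +oo] --> (1 : R)).

Definition supported01 (R : realType) (F : R -> R) : Prop :=
  (forall v : R, v < 0 -> F v = 0) /\ F 1 = 1.

Definition quantile (R : realType) (F : R -> R) (p : R) : R :=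
  inf [set v : R | 0 <= v <= 1 /\ p <= F v].

Definition revenue (R : realType) (F : R -> R) (q : R) : R :=
  q * quantile F (1 - q).

Definition concave_on01 (R : realType) (f : R -> R) : Prop :=
  forall x y t : R, 0 <= x <= 1 -> 0 <= y <= 1 -> 0 <= t <= 1 ->
    t * f x + (1 - t) * f y <= f (t * x + (1 - t) * y).

Definition regular (R : realType) (F : R -> R) : Prop :=
  concave_on01 (revenue F).

Definition regular01 (R : realType) (F : R -> R) : Prop :=
  is_cdf F /\ supported01 F /\ regular F.

Definition levy_ok (R : realType) (F G : R -> R) (e : R) : Prop :=
  forall v : R, F (v - e) - e <= G v /\ G v <= F (v + e) + e.

Definition levy (R : realType) (F G : R -> R) : R :=
  inf [set e : R | 0 <= e /\ levy_ok F G e].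

Definition describable (R : realType) (C : (R -> R) -> Prop) (b : nat) (eps : R)
  : Prop :=
  exists C' : seq (R -> R),
    (size C' <= 2 ^ b)%N /\
    (forall F', F' \in C' -> is_cdf F') /\
    (forall F, C F -> exists2 F', F' \in C' & levy F F' <= eps).

(* Main.v *)
(* Upper bound: writing q = 1 / (1 + u), concavity of q |-> q F^-1(1 - q) turns
   into concavity in u > 0 of the nondecreasing function
   y(u) = F^-1(1 - 1 / (1 + u)), with values in [0, 1].  On a geometric grid of
   ratio exp(e), the tangent intercept y - u y' is nondecreasing with values in
   [0, 1], so the potential ln u + (y - u y') has range O(ln(1/e)).  On a block
   where the potential varies by at most sqrt e, y is within O(e) of its chord.
   Hence the endpoints of these O(ln(1/e) / sqrt e) blocks, together with
   e-rounded values of y there, determine F up to O(e) in Levy distance, and one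
   regular distribution per code forms the cover.

   Lower bound: F is regular when 1 / (1 - F) is convex.  Take for 1 / (1 - F)
   the function 1 + v plus the upper envelope of 0 and a subset S of the tangents
   to v^2 at the points k / N; omitting one tangent changes F by at least
   1 / (9 N^2) at its point, so the 2^(N-1) choices of S stay separated for
   N ~ eps^(-1/2). *)

Require Import Defs.
From mathcomp Require Import all_boot all_order all_algebra.
From mathcomp Require Import all_classical all_reals all_analysis.
From mathcomp Require Import ring lra.
Set Implicit Arguments. Unset Strict Implicit. Unset Printing Implicit Defensive.
Import Order.TTheory GRing.Theory Num.Theory.
Import numFieldNormedType.Exports.
Local Open Scope classical_set_scope.
Local Open Scope ring_scope.

(** * Quantiles, CDFs and the Levy distance *)

Lemma has_inf_quantile (R : realType) (F : R -> R) (p : R) :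
  F 1 = 1 -> p <= 1 -> has_inf [set v : R | 0 <= v <= 1 /\ p <= F v].
Proof.
move=> F1 p1; split; first by exists 1; rewrite /= F1 p1 ler01 lexx.
by exists 0 => v /= [/andP[]].
Qed.

Lemma quantile_le (R : realType) (F : R -> R) (p v : R) :
  0 <= v <= 1 -> p <= F v -> quantile F p <= v.
Proof.
move=> v01 pv; apply: ge_inf; last by split.
by exists 0 => w /= [/andP[]].
Qed.

Lemma le_quantile (R : realType) (F : R -> R) (p w : R) :
  F 1 = 1 -> p <= 1 ->
  (forall v, 0 <= v <= 1 -> p <= F v -> w <= v) -> w <= quantile F p.
Proof.
move=> F1 p1 h; apply: lb_le_inf; first by case: (has_inf_quantile F1 p1).
by move=> v /= [v01 pv]; exact: h.
Qed.

Lemma quantile_lt (R : realType) (F : R -> R) (p w : R) :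
  F 1 = 1 -> p <= 1 -> quantile F p < w ->
  exists v, [/\ 0 <= v <= 1, p <= F v & v < w].
Proof.
move=> F1 p1 /inf_lt[]; first by case: (has_inf_quantile F1 p1).
by move=> v /= [v01 pv] vw; exists v.
Qed.

Lemma quantile_itv (R : realType) (F : R -> R) (p : R) :
  F 1 = 1 -> p <= 1 -> 0 <= quantile F p <= 1.
Proof.
move=> F1 p1; apply/andP; split.
  by apply: le_quantile => // v /andP[].
by apply: quantile_le; rewrite ?F1 // ler01 lexx.
Qed.

Lemma quantile_homo (R : realType) (F : R -> R) (p p' : R) :
  F 1 = 1 -> p <= p' -> p' <= 1 -> quantile F p <= quantile F p'.
Proof.
move=> F1 pp p1; apply: le_quantile => // v v01 pv.
by apply: quantile_le => //; exact: le_trans pv.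
Qed.

Lemma is_cdf_itv (R : realType) (F : R -> R) (v : R) :
  is_cdf F -> 0 <= F v <= 1.
Proof.
case=> Fm [_ [F0 F1]]; apply/andP; split.
  rewrite -(cvg_lim _ F0) //; apply: limr_le; first by apply/cvg_ex; exists 0.
  by near=> x; apply: Fm; near: x; apply: nbhs_ninfty_le; exact: num_real.
rewrite -(cvg_lim _ F1) //; apply: limr_ge; first by apply/cvg_ex; exists 1.
by near=> x; apply: Fm; near: x; apply: nbhs_pinfty_ge; exact: num_real.
Unshelve. all: by end_near. Qed.

Lemma levy_le (R : realType) (F G : R -> R) (e : R) :
  0 <= e -> levy_ok F G e -> levy F G <= e.
Proof.
move=> e0 ok; apply: ge_inf; last by split.
by exists 0 => w /= [].
Qed.

Lemma levy_okW (R : realType) (F G : R -> R) (e e' : R) :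
  {homo F : x y / x <= y} -> e <= e' -> levy_ok F G e -> levy_ok F G e'.
Proof.
move=> Fm ee ok v; have [h1 h2] := ok v; split.
  by have := Fm (v - e') (v - e); lra.
by have := Fm (v + e) (v + e'); lra.
Qed.

(** [levy] is an infimum, not known here to be attained, so an admissible shift costs a strict
    increase. The shift 1 is always admissible, as CDFs take values in [0, 1]. *)
Lemma levy_ok_lt (R : realType) (F G : R -> R) (e e' : R) :
  is_cdf F -> is_cdf G -> levy F G <= e -> e < e' -> levy_ok F G e'.
Proof.
move=> Fc Gc le_e ee'.
have /inf_lt[] : levy F G < e' by exact: le_lt_trans ee'.
  exists 1; split => // v.
  have := is_cdf_itv v Gc; have := is_cdf_itv (v - 1) Fc.
  by have := is_cdf_itv (v + 1) Fc; lra.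
by move=> x /= [x0 ok] xe; apply: levy_okW ok; [case: Fc|exact: ltW].
Qed.

(** * Lower bound *)

Definition convex_fun (R : realType) (H : R -> R) : Prop :=
  forall x y l, 0 <= l <= 1 ->
    H (l * x + (1 - l) * y) <= l * H x + (1 - l) * H y.

Definition lipschitz_incr (R : realType) (K : R) (H : R -> R) : Prop :=
  forall x y, x <= y -> H x <= H y <= H x + K * (y - x).

(** [H] plays the role of 1 / (1 - F). As [H] stays finite, the remaining mass becomes an atom at
    1. *)
Definition survival_cdf (R : realType) (H : R -> R) (v : R) : R :=
  if v < 1 then 1 - (H v)^-1 else 1.

Lemma survival_cdf_ge1 (R : realType) (H : R -> R) (v : R) :
  1 <= v -> survival_cdf H v = 1.
Proof. by rewrite /survival_cdf ltNge => ->. Qed.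

Lemma survival_cdf_lt1 (R : realType) (H : R -> R) (v : R) :
  v < 1 -> survival_cdf H v = 1 - (H v)^-1.
Proof. by rewrite /survival_cdf => ->. Qed.

(** Since H >= 1, the denominator in 1 / H x - 1 / H y is at least 1, so inversion keeps the
    Lipschitz constant. *)
Lemma survival_cdf_lipschitz (R : realType) (K : R) (H : R -> R) (x y : R) :
  (forall v, 1 <= H v) -> lipschitz_incr K H -> x <= y -> y < 1 ->
  survival_cdf H x <= survival_cdf H y <= survival_cdf H x + K * (y - x).
Proof.
move=> H1 HL xy y1; rewrite !survival_cdf_lt1 //; last exact: le_lt_trans y1.
have /andP[h1 h2] := HL _ _ xy; have hx := H1 x; have hy := H1 y.
have x0 : 0 < H x by lra.
have y0 : 0 < H y by lra.
have -> : 1 - (H y)^-1 = 1 - (H x)^-1 + (H y - H x) / (H x * H y).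
  by field; rewrite !gt_eqF.
have xy1 : 1 <= H x * H y by rewrite -[leLHS]mulr1 ler_pM.
have d0 : 0 <= (H y - H x) / (H x * H y) by apply: divr_ge0; lra.
have : (H y - H x) / (H x * H y) <= H y - H x.
  by rewrite ler_pdivrMr ?ler_peMr //; lra.
by move=> ?; apply/andP; split; lra.
Qed.

Lemma survival_cdf_homo (R : realType) (K : R) (H : R -> R) :
  (forall v, 1 <= H v) -> lipschitz_incr K H ->
  {homo survival_cdf H : x y / x <= y}.
Proof.
move=> H1 HL x y xy; have [y1|y1] := ltP y 1.
  by have /andP[] := survival_cdf_lipschitz H1 HL xy y1.
rewrite (survival_cdf_ge1 _ y1) /survival_cdf; case: ifP => // _.
by rewrite gerBl invr_ge0 (le_trans ler01).
Qed.

Lemma survival_cdf_is_cdf (R : realType) (K : R) (H : R -> R) :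
  (forall v, 1 <= H v) -> lipschitz_incr K H ->
  (forall v, v <= 0 -> H v = 1) -> is_cdf (survival_cdf H).
Proof.
move=> H1 HL H0; have Fm := survival_cdf_homo H1 HL.
split; [exact: Fm|split; [|split]].
- move=> x; have [x1|x1] := ltP x 1; last first.
    rewrite survival_cdf_ge1 //; apply: cvg_near_cst; near=> y.
    by rewrite survival_cdf_ge1 //; apply: (le_trans x1); near: y;
      exact: nbhs_right_ge.
  apply: (@squeeze_cvgr _ _ _ _ (fun=> survival_cdf H x)
    (fun y => survival_cdf H x + K * (y - x))).
  + near=> y; apply: (survival_cdf_lipschitz H1 HL).
      by near: y; exact: nbhs_right_ge.
    by near: y; exact: nbhs_right_lt.
  + exact: cvg_cst.
  + rewrite -[X in _ --> X]addr0 -[X in _ + X](mulr0 K) -(subrr x).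
    apply: cvgD; first exact: cvg_cst.
    apply: cvgM; first exact: cvg_cst.
    apply: cvgB; last exact: cvg_cst.
    by apply: cvg_at_right_filter; exact: cvg_id.
- apply: cvg_near_cst; near=> x.
  have x0 : x <= 0 by near: x; apply: nbhs_ninfty_le; exact: num_real.
  by rewrite survival_cdf_lt1 ?H0 ?invr1 ?subrr // (le_lt_trans x0).
- apply: cvg_near_cst; near=> x.
  by rewrite survival_cdf_ge1 //; near: x; apply: nbhs_pinfty_ge; exact: num_real.
Unshelve. all: by end_near. Qed.

(* Regularity of F is convexity of 1 / (1 - F). *)
Lemma survival_cdf_regular (R : realType) (K : R) (H : R -> R) :
  (forall v, 1 <= H v) -> lipschitz_incr K H -> convex_fun H ->
  (forall v, v <= 0 -> H v = 1) -> (forall x y, 0 <= x < y -> H x < H y) ->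
  regular (survival_cdf H).
Proof.
move=> H1 HL HC H0 Hs.
have F1 : survival_cdf H 1 = 1 by rewrite survival_cdf_ge1.
(* H is at most 1 / q at every point below the quantile, and Lipschitz continuity carries the bound
   to the quantile itself. The product form covers q = 0. *)
have key q : 0 <= q <= 1 -> q * H (quantile (survival_cdf H) (1 - q)) <= 1.
  move=> /andP[q0 q1]; have p1 : 1 - q <= 1 by lra.
  have /andP[] := quantile_itv F1 p1.
  set v := quantile _ _; rewrite le_eqVlt => /predU1P[<- _|v0 v1].
    by rewrite H0 // mulr1.
  have below w : 0 <= w -> w < v -> q * H w <= 1.
    move=> w0 wv; have w1 : w < 1 by exact: lt_le_trans v1.
    have : survival_cdf H w < 1 - q.
      rewrite ltNge; apply/negP => pw.
      have : v <= w by apply: quantile_le => //; rewrite w0 ltW.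
      by rewrite leNgt wv.
    rewrite survival_cdf_lt1 // => qH.
    have hw : 0 < H w by have := H1 w; lra.
    have : q * H w <= (H w)^-1 * H w by rewrite ler_pM2r //; lra.
    by rewrite mulVf // gt_eqF.
  apply/ler_addgt0Pr => e e0.
  (* So close to v that the Lipschitz bound costs at most e; the + 1 keeps the denominator
     positive. *)
  pose w := Num.max 0 (v - e / (q * `|K| + 1)).
  have den : 0 < q * `|K| + 1 by have := normr_ge0 K; nra.
  have de : 0 < e / (q * `|K| + 1) by rewrite divr_gt0.
  have w0 : 0 <= w by rewrite /w le_max lexx.
  have wv : w < v by rewrite /w gt_max v0 /=; lra.
  have /andP[_ Lw] := HL _ _ (ltW wv).
  have Bw := below _ w0 wv.
  have vw : v - w <= e / (q * `|K| + 1).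
    have : v - e / (q * `|K| + 1) <= w by rewrite /w le_max lexx orbT.
    by lra.
  have : q * (K * (v - w)) <= e.
    apply: (@le_trans _ _ (q * `|K| * (e / (q * `|K| + 1)))).
      rewrite -mulrA ler_wpM2l //; apply: (@le_trans _ _ (`|K| * (v - w))); last first.
        by rewrite ler_wpM2l.
      by rewrite ler_wpM2r ?ler_norm // subr_ge0 ltW.
    rewrite mulrA ler_pdivrMr //; nra.
  by nra.
move=> q1 q2 t q1i q2i ti; rewrite /revenue.
have k1 := key _ q1i; have k2 := key _ q2i; move: k1 k2.
set v1 := quantile _ (1 - q1); set v2 := quantile _ (1 - q2); move=> k1 k2.
have [/andP[t0 t1] /andP[q10 q11] /andP[q20 q21]] := And3 ti q1i q2i.
have a1 : 0 <= t * q1 by rewrite mulr_ge0.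
have a2 : 0 <= (1 - t) * q2 by rewrite mulr_ge0 // subr_ge0.
have qi : 0 <= t * q1 + (1 - t) * q2 <= 1 by apply/andP; split; nra.
set q := _ + _ in qi *.
have := qi => /andP[]; rewrite le_eqVlt => /predU1P[q0 _|q0 qle1].
  rewrite -q0 mul0r.
  have : t * q1 = 0 /\ (1 - t) * q2 = 0.
    by rewrite /q in q0; split; lra.
  by case; rewrite !mulrA => -> ->; rewrite !mul0r addr0.
(* With this weight the combination of revenues is q times a convex combination of the two
   quantiles. *)
pose l := t * q1 / q.
have l1 : 1 - l = (1 - t) * q2 / q by rewrite /l /q; field; rewrite gt_eqF.
have li : 0 <= l <= 1.
  have l0 : 0 <= l by rewrite divr_ge0 // ltW.
  by rewrite l0 -subr_ge0 l1 divr_ge0 // ltW.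
have -> : t * (q1 * v1) + (1 - t) * (q2 * v2) = q * (l * v1 + (1 - l) * v2).
  by rewrite l1 /l; field; rewrite gt_eqF.
rewrite ler_pM2l //; apply: le_quantile => //; first by lra.
(* For v below that combination, strict growth and convexity of H give H v < 1 / q, hence F v < 1 -
   q. *)
move=> v v01; apply: contraTT; rewrite -!ltNge => vw.
have v1i : 0 <= v1 <= 1 by apply: quantile_itv => //; lra.
have v2i : 0 <= v2 <= 1 by apply: quantile_itv => //; lra.
have v_lt1 : v < 1 by apply: lt_le_trans vw _; nra.
have Hvw : H v < H (l * v1 + (1 - l) * v2).
  by apply: Hs; rewrite vw; case/andP: v01 => ->.
have := HC v1 v2 l li => Hw.
have qq : (l * H v1 + (1 - l) * H v2) * q <= 1.
  have -> : (l * H v1 + (1 - l) * H v2) * q =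
            t * (q1 * H v1) + (1 - t) * (q2 * H v2).
    by rewrite l1 /l; field; rewrite gt_eqF.
  by nra.
rewrite survival_cdf_lt1 //.
have : q < (H v)^-1; last by lra.
have hv := H1 v.
rewrite -[ltRHS]mul1r ltr_pdivlMr; last by lra.
by nra.
Qed.

(** * Upper envelopes of tangents to the parabola v^2 *)

Definition tangent (R : realType) (N k : nat) (v : R) : R :=
  2 * (k%:R / N%:R) * v - (k%:R / N%:R) ^+ 2.

Lemma tangent_le_sqr (R : realType) (N k : nat) (v : R) :
  tangent N k v <= v ^+ 2.
Proof.
by have := sqr_ge0 (v - k%:R / N%:R); rewrite /tangent sqrrB; lra.
Qed.

(** The tangent at k / N lies exactly ((j - k) / N)^2 below the parabola at j / N, and distinct
    integers differ by at least 1. *)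
Lemma tangent_gap (R : realType) (N k j : nat) : (0 < N)%N -> k != j ->
  tangent N k (j%:R / N%:R) <= (j%:R / N%:R) ^+ 2 - (N%:R ^+ 2)^-1 :> R.
Proof.
move=> N0 kj; have N0' : 0 < N%:R :> R by rewrite ltr0n.
rewrite /tangent -subr_ge0.
have -> : (j%:R / N%:R) ^+ 2 - (N%:R ^+ 2)^-1 -
   (2 * (k%:R / N%:R) * (j%:R / N%:R) - (k%:R / N%:R) ^+ 2) =
   ((j%:R - k%:R) ^+ 2 - 1) / N%:R ^+ 2 :> R.
  by field; rewrite gt_eqF.
apply: divr_ge0; last by rewrite exprn_ge0 // ltW.
have [kj'|kj'] := ltnP k j.
  have : k.+1%:R <= j%:R :> R by rewrite ler_nat.
  by rewrite -natr1; nra.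
have : j.+1%:R <= k%:R :> R by rewrite ler_nat ltn_neqAle eq_sym kj.
by rewrite -natr1; nra.
Qed.

(** The term max 0 v forces strict growth on v >= 0 whatever [S] is, and the 0 in the big maximum
    keeps the value 1 for v <= 0. Shifting both indices by one puts the tangency points strictly
    inside (0, 1). *)
Definition bumps (R : realType) (n : nat) (S : {set 'I_n}) (v : R) : R :=
  1 + Num.max 0 v + \big[Num.max/0]_(k in S) tangent n.+1 k.+1 v.

Definition node (R : realType) (n : nat) (k : 'I_n) : R := k.+1%:R / n.+1%:R.

Lemma node_itv (R : realType) (n : nat) (k : 'I_n) : 0 <= node R k <= 1.
Proof.
rewrite /node divr_ge0 //= ler_pdivrMr ?ltr0n // mul1r ler_nat.
exact: ltnW (ltn_ord k).
Qed.

Lemma tangent_lipschitz (R : realType) (n : nat) (k : 'I_n) :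
  lipschitz_incr 2 (tangent n.+1 k.+1 : R -> R).
Proof.
move=> x y xy; have := node_itv R k; rewrite /node /tangent.
move: (_ / _) => a /andP[a0 a1].
have h1 : 0 <= a * (y - x) by rewrite mulr_ge0 // subr_ge0.
have h2 : 0 <= (1 - a) * (y - x) by rewrite mulr_ge0 // subr_ge0.
by apply/andP; split; lra.
Qed.

Lemma bumps_max_ge0 (R : realType) (n : nat) (S : {set 'I_n}) (v : R) :
  0 <= \big[Num.max/0]_(k in S) tangent n.+1 k.+1 v.
Proof. exact: bigmax_ge_id. Qed.

Lemma bumps_ge1 (R : realType) (n : nat) (S : {set 'I_n}) (v : R) :
  1 <= bumps S v.
Proof.
have := bumps_max_ge0 S v; rewrite /bumps.
by have : 0 <= Num.max 0 v; [rewrite le_max lexx|lra].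
Qed.

Lemma bumps_le0 (R : realType) (n : nat) (S : {set 'I_n}) (v : R) :
  v <= 0 -> bumps S v = 1.
Proof.
move=> v0; rewrite /bumps (max_l v0) addr0.
suff -> : \big[Num.max/0]_(k in S) tangent n.+1 k.+1 v = 0 by rewrite addr0.
apply/eqP; rewrite eq_le bumps_max_ge0 andbT; apply: bigmax_le => // k _.
by have /andP[h _] := tangent_lipschitz k v0; rewrite (le_trans h) // /tangent
  mulr0 sub0r oppr_le0 sqr_ge0.
Qed.

Lemma bumps_lipschitz (R : realType) (n : nat) (S : {set 'I_n}) :
  lipschitz_incr 3 (bumps S : R -> R).
Proof.
move=> x y xy; rewrite /bumps.
have /andP[m1 m2] : Num.max 0 x <= Num.max 0 y <= Num.max 0 x + (y - x).
  by apply/andP; split; rewrite /Num.max; case: ifP => ?; case: ifP => ?; lra.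
have b1 : \big[Num.max/0]_(k in S) tangent n.+1 k.+1 x <=
          \big[Num.max/0]_(k in S) tangent n.+1 k.+1 y.
  apply: le_bigmax2 => k _.
  by have /andP[] := tangent_lipschitz k xy.
have b2 : \big[Num.max/0]_(k in S) tangent n.+1 k.+1 y <=
          \big[Num.max/0]_(k in S) tangent n.+1 k.+1 x + 2 * (y - x).
  apply: bigmax_le => [|k kS].
    by have := bumps_max_ge0 S x; lra.
  have : tangent n.+1 k.+1 x <= \big[Num.max/0]_(k in S) tangent n.+1 k.+1 x.
    exact: (le_bigmax_cond _ (fun k : 'I_n => tangent n.+1 k.+1 x)).
  by have /andP[] := tangent_lipschitz k xy; lra.
by apply/andP; split; lra.
Qed.

Lemma bumps_convex (R : realType) (n : nat) (S : {set 'I_n}) :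
  convex_fun (bumps S : R -> R).
Proof.
move=> x y l /andP[l0 l1]; rewrite /bumps.
set z := l * x + _.
have m : Num.max 0 z <= l * Num.max 0 x + (1 - l) * Num.max 0 y.
  have m0 a : 0 <= Num.max 0 a :> R by rewrite le_max lexx.
  have m1 a : a <= Num.max 0 a :> R by rewrite le_max lexx orbT.
  have := (m0 x, m1 x, m0 y, m1 y) => -[[[? ?] ?] ?].
  by rewrite ge_max /z; apply/andP; split; nra.
have b : \big[Num.max/0]_(k in S) tangent n.+1 k.+1 z <=
   l * \big[Num.max/0]_(k in S) tangent n.+1 k.+1 x +
   (1 - l) * \big[Num.max/0]_(k in S) tangent n.+1 k.+1 y.
  apply: bigmax_le => [|k kS].
    by have := bumps_max_ge0 S x; have := bumps_max_ge0 S y; nra.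
  have h w : tangent n.+1 k.+1 w <=
             \big[Num.max/0]_(k in S) tangent n.+1 k.+1 w :> R.
    exact: (le_bigmax_cond _ (fun k : 'I_n => tangent n.+1 k.+1 w)).
  have -> : tangent n.+1 k.+1 z =
            l * tangent n.+1 k.+1 x + (1 - l) * tangent n.+1 k.+1 y.
    by rewrite /tangent /z; ring.
  by rewrite lerD // ler_wpM2l // subr_ge0.
by nra.
Qed.

Lemma bumps_incr (R : realType) (n : nat) (S : {set 'I_n}) (x y : R) :
  0 <= x < y -> bumps S x < bumps S y.
Proof.
move=> /andP[x0 xy]; rewrite /bumps.
rewrite (max_r x0) (max_r (le_trans x0 (ltW xy))).
apply: ltr_leD; first by rewrite ltrD2l.
apply: le_bigmax2 => k _.
by have /andP[] := tangent_lipschitz k (ltW xy).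
Qed.

Lemma bumps_le3 (R : realType) (n : nat) (S : {set 'I_n}) (v : R) :
  0 <= v <= 1 -> bumps S v <= 3.
Proof.
move=> /andP[v0 v1]; rewrite /bumps (max_r v0).
have : \big[Num.max/0]_(k in S) tangent n.+1 k.+1 v <= 1; last by lra.
apply: bigmax_le => // k _; have := tangent_le_sqr n.+1 k.+1 v.
by nra.
Qed.

Lemma bumps_regular01 (R : realType) (n : nat) (S : {set 'I_n}) :
  regular01 (survival_cdf (bumps S : R -> R)).
Proof.
have H1 := @bumps_ge1 R n S; have HL := @bumps_lipschitz R n S.
have H0 := @bumps_le0 R n S; split; [|split].
- exact: survival_cdf_is_cdf H1 HL H0.
- split=> [v v0|]; last by rewrite survival_cdf_ge1.
  by rewrite survival_cdf_lt1 ?H0 ?invr1 ?subrr 1?ltW // (lt_trans v0).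
- exact: survival_cdf_regular H1 HL (@bumps_convex R n S) H0
    (@bumps_incr R n S).
Qed.

(** * Separation of the family, and counting *)

Lemma bumps_node_in (R : realType) (n : nat) (S : {set 'I_n}) (k : 'I_n) :
  k \in S -> 1 + node R k + node R k ^+ 2 <= bumps S (node R k).
Proof.
move=> kS; have /andP[v0 _] := node_itv R k.
rewrite /bumps (max_r v0).
rewrite lerD2l.
apply: le_trans (le_bigmax_cond _ (fun k : 'I_n => tangent n.+1 k.+1 (node R _)) kS).
by rewrite /tangent -/(node R k); lra.
Qed.

Lemma bumps_node_notin (R : realType) (n : nat) (S : {set 'I_n}) (k : 'I_n) :
  k \notin S ->
  bumps S (node R k) <= 1 + node R k + node R k ^+ 2 - (n.+1%:R ^+ 2)^-1.
Proof.
move=> kS; have /andP[v0 _] := node_itv R k.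
rewrite /bumps (max_r v0).
rewrite -[leRHS]addrA lerD2l; apply: bigmax_le => [|j jS].
  rewrite subr_ge0 /node expr_div_n ler_peMl ?invr_ge0 ?exprn_ge0 //.
  by rewrite -natrX ler1n expn_gt0.
by apply: tangent_gap => //; apply: contraNneq kS => -[/val_inj <-].
Qed.

(** At a node of [S] missing from [T], the two CDFs differ by at least 1 / (9 (n + 1)^2), because
    [bumps] is at most 3 on [0, 1]. A shift by e changes the CDF of [T] by at most 3 e and the slack
    adds e, so 36 e would reach 1 / (n + 1)^2. The first bound on e keeps v + e left of the atom at
    1. *)
Lemma bumps_levy_sub (R : realType) (n : nat) (S T : {set 'I_n}) (e : R) :
  0 <= e -> e * n.+1%:R < 1 -> 36 * e * n.+1%:R ^+ 2 < 1 ->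
  levy_ok (survival_cdf (bumps T)) (survival_cdf (bumps S)) e -> S \subset T.
Proof.
move=> e0 en1 en2 ok; apply/fintype.subsetP => k kS; apply: contraT => kT.
have := bumps_node_in R kS; have := bumps_node_notin R kT.
have := node_itv R k; set v := node R k => vi hT hS.
have n0 : 0 < n.+1%:R :> R by rewrite ltr0n.
have vn : v + n.+1%:R^-1 <= 1.
  by rewrite /v /node -{2}[n.+1%:R^-1]mul1r -mulrDl ler_pdivrMr // mul1r natr1 ler_nat ltnS.
clearbody v.
have eg : 36 * e < (n.+1%:R ^+ 2)^-1.
  by rewrite -[ltRHS]mul1r ltr_pdivlMr // exprn_gt0.
have g0 : 0 <= (n.+1%:R ^+ 2)^-1 :> R by rewrite invr_ge0 exprn_ge0.
have en : e < n.+1%:R^-1 by rewrite -[ltRHS]mul1r ltr_pdivlMr.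
have [_ /=] := ok v.
have ve1 : v + e < 1 by apply: lt_le_trans vn; rewrite ltrD2l.
have ve : v <= v + e by rewrite lerDl.
have /andP[_] := survival_cdf_lipschitz (bumps_ge1 T) (bumps_lipschitz T) ve ve1.
have v_lt1 : v < 1 by exact: le_lt_trans ve1.
rewrite !(survival_cdf_lt1 _ v_lt1).
have S3 := bumps_le3 S vi; have S1 := bumps_ge1 S v.
have T3 := bumps_le3 T vi; have T1 := bumps_ge1 T v.
move: (_ ^- 2) hT eg g0 => g hT eg g0.
have gap : g / 9 <= (bumps T v)^-1 - (bumps S v)^-1.
  have -> : (bumps T v)^-1 - (bumps S v)^-1 =
            (bumps S v - bumps T v) / (bumps T v * bumps S v).
    by field; apply/andP; split; rewrite gt_eqF //; lra.
  have TS : 0 < bumps T v * bumps S v by rewrite mulr_gt0 //; lra.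
  have TS9 : bumps T v * bumps S v <= 9.
    have -> : 9 = 3 * 3 :> R by ring.
    by apply: ler_pM => //; lra.
  apply: ler_pM; [by []|by []|by lra|].
  by rewrite lef_pV2 ?posrE.
by lra.
Qed.

(** Two sets served by the same representative are within 4 eps: the triangle inequality with 2 eps
    on each side, any number above eps being admissible. They are then equal, so the 2^n sets inject
    into the cover. *)
Lemma describable_lower (R : realType) (n b : nat) (eps : R) :
  0 < eps -> 4 * eps * n.+1%:R < 1 -> 144 * eps * n.+1%:R ^+ 2 < 1 ->
  describable (@regular01 R) b eps -> (n <= b)%N.
Proof.
move=> e0 en1 en2 [C [Cb [Ccdf Ccov]]].
have near_C (S : {set 'I_n}) : exists i : 'I_(size C),
    levy (survival_cdf (bumps S)) (nth (fun=> 0) C i) <= eps.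
  have [F' F'C le_eps] := Ccov _ (@bumps_regular01 R n S).
  have iC : (index F' C < size C)%N by rewrite index_mem.
  by exists (Ordinal iC); rewrite /= nth_index.
have [g gP] := choice near_C.
suff ginj : injective g.
  have := leq_card g ginj.
  rewrite card_ord -cardsT -powersetT card_powerset cardsT card_ord => /leq_trans/(_ Cb).
  by rewrite leq_exp2l.
have sub S T : g S = g T -> S \subset T.
  move=> gST.
  have ccdf (U : {set 'I_n}) : is_cdf (survival_cdf (bumps U : R -> R)).
    by case: (bumps_regular01 R U).
  have gcdf : is_cdf (nth (fun=> 0) C (g S)) by apply: Ccdf; exact: mem_nth.
  have e2 : eps < 2 * eps by lra.
  have okS := levy_ok_lt (ccdf S) gcdf (gP S) e2.
  have := gP T; rewrite -gST => gT.
  have okT := levy_ok_lt (ccdf T) gcdf gT e2.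
  apply: (@bumps_levy_sub R n S T (4 * eps)); rewrite ?mulrA //; try lra.
  move=> v; split.
    have := (okT (v - 2 * eps)).1; have := (okS (v - 2 * eps)).2.
    have -> : v - 2 * eps - 2 * eps = v - 4 * eps by ring.
    by rewrite subrK; lra.
  have := (okS (v + 2 * eps)).1; have := (okT (v + 2 * eps)).2.
  have -> : v + 2 * eps + 2 * eps = v + 4 * eps by ring.
  by rewrite addrK; lra.
by move=> S T gST; apply/eqP; rewrite finset.eqEsubset !sub.
Qed.

Lemma lower_bound (R : realType) (eps : R) (b : nat) :
  0 < eps -> eps < 48^-1 ^+ 2 -> describable (@regular01 R) b eps ->
  48^-1 * (Num.sqrt eps)^-1 <= b%:R.
Proof.
move=> e0 e1 desc.
have s0 : 0 < Num.sqrt eps by rewrite sqrtr_gt0.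
have ss : Num.sqrt eps ^+ 2 = eps by rewrite sqr_sqrtr // ltW.
have s1 : Num.sqrt eps < 48^-1 by nra.
set r := Num.sqrt eps in s0 ss s1 *.
pose x := (24 * r)^-1; pose n := Num.truncn x.
have rx : r * x = 24^-1 by rewrite /x; field; rewrite gt_eqF.
have x0 : 0 < x by rewrite invr_gt0 mulr_gt0.
have /andP[nx xn] := truncn_itv (ltW x0).
have x2 : 2 <= x by nra.
have rn : r * n.+1%:R <= 1 / 16 by rewrite -natr1; nra.
have n0 : 0 <= n.+1%:R :> R by [].
have : (n <= b)%N.
  by apply: describable_lower desc => //; rewrite -ss; nra.
rewrite -(ler_nat R); apply: le_trans.
have -> : 48^-1 * r^-1 = x / 2 by rewrite /x; field; rewrite gt_eqF.
by rewrite -natr1 in xn; lra.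
Qed.
(** * Upper bound *)

(* In the variable u = 1/q - 1, concavity of the revenue curve becomes
   concavity of the quantile function itself. *)
Definition tail_quantile (R : realType) (F : R -> R) (u : R) : R :=
  quantile F (1 - (1 + u)^-1).

(** Concavity is the chord inequality cleared of denominators; the left point may be 0, which
    [intercept_itv] uses. *)
Definition profile (R : realType) (y : R -> R) : Prop :=
  [/\ forall a b c, 0 <= a -> a < b -> b < c ->
        (c - b) * y a + (b - a) * y c <= (c - a) * y b,
      forall a b, 0 <= a -> a <= b -> y a <= y b
    & forall a, 0 <= a -> 0 <= y a <= 1].

Lemma tail_quantile_profile (R : realType) (F : R -> R) :
  regular01 F -> profile (tail_quantile F).
Proof.
move=> [_ [[_ F1] Freg]].
have p1 (u : R) : 0 <= u -> 1 - (1 + u)^-1 <= 1.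
  by move=> u0; rewrite gerBl invr_ge0 addr_ge0.
split=> [a b c a0 ab bc|a b a0 ab|a a0]; last first.
- by apply: quantile_itv => //; exact: p1.
- apply: quantile_homo => //; last by apply: p1; exact: le_trans ab.
  by rewrite lerD2l lerN2 lef_pV2 ?posrE; lra.
have [A0 B0 C0] : [/\ 0 < 1 + a, 0 < 1 + b & 0 < 1 + c] by split; lra.
have itv (z : R) : 0 < 1 + z -> 0 <= z -> 0 <= (1 + z)^-1 <= 1.
  by move=> z1 z0; rewrite invr_ge0 (ltW z1) /= invf_le1 // lerDl.
(* The weight that makes 1 / (1 + b) the combination of 1 / (1 + a) and 1 / (1 + c); up to the
   factor (c - a) (1 + b), revenue concavity becomes the chord inequality. *)
pose t := (c - b) * (1 + a) / ((c - a) * (1 + b)).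
have ca0 : 0 < c - a by lra.
have t1 : 1 - t = (b - a) * (1 + c) / ((c - a) * (1 + b)).
  by rewrite /t; field; rewrite !gt_eqF.
have ti : 0 <= t <= 1.
  have t0 : 0 <= t by apply: divr_ge0; apply: mulr_ge0; lra.
  by rewrite t0 -subr_ge0 t1; apply: divr_ge0; apply: mulr_ge0; lra.
have := Freg (1 + a)^-1 (1 + c)^-1 t (itv _ A0 a0).
have C0' : 0 <= c by lra.
have B0' : 0 <= b by lra.
move=> /(_ (itv _ C0 C0') ti).
have -> : t * (1 + a)^-1 + (1 - t) * (1 + c)^-1 = (1 + b)^-1.
  by rewrite t1 /t; field; rewrite !gt_eqF.
rewrite /revenue -/(tail_quantile F a) -/(tail_quantile F b).
rewrite -/(tail_quantile F c) t1 /t.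
set ya := tail_quantile F a; set yb := tail_quantile F b.
set yc := tail_quantile F c.
have -> : (c - b) * (1 + a) / ((c - a) * (1 + b)) * ((1 + a)^-1 * ya) +
   (b - a) * (1 + c) / ((c - a) * (1 + b)) * ((1 + c)^-1 * yc) =
   ((c - b) * ya + (b - a) * yc) / ((c - a) * (1 + b)).
  by field; rewrite !gt_eqF.
have -> : (1 + b)^-1 * yb = (c - a) * yb / ((c - a) * (1 + b)).
  by field; rewrite !gt_eqF.
by rewrite ler_pM2r // invr_gt0 mulr_gt0.
Qed.

(** * Slopes and intercepts on a geometric grid *)

(** Starting at e leaves out only probability levels below e, and the ratio exp(e) keeps consecutive
    levels within e. *)
Definition grid (R : realType) (e : R) (i : nat) : R := e * expR (e * i%:R).

Definition slope (R : realType) (e : R) (y : R -> R) (i : nat) : R :=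
  (y (grid e i.+1) - y (grid e i)) / (grid e i.+1 - grid e i).

(** The height at 0 of the line through the chord over cell i. *)
Definition intercept (R : realType) (e : R) (y : R -> R) (i : nat) : R :=
  y (grid e i) - grid e i * slope e y i.

(* [e * i] is [ln (grid e i / e)]. *)
Definition potential (R : realType) (e : R) (y : R -> R) (i : nat) : R :=
  e * i%:R + intercept e y i.

Lemma grid_gt0 (R : realType) (e : R) (i : nat) : 0 < e -> 0 < grid e i.
Proof. by move=> e0; rewrite mulr_gt0 ?expR_gt0. Qed.

Lemma grid_lt (R : realType) (e : R) (i j : nat) :
  0 < e -> (i < j)%N -> grid e i < grid e j.
Proof. by move=> e0 ij; rewrite ltr_pM2l // ltr_expR ltr_pM2l // ltr_nat. Qed.

Lemma grid_sub (R : realType) (e : R) (i j : nat) : 0 < e -> (i <= j)%N ->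
  grid e j - grid e i <= grid e j * (e * j%:R - e * i%:R).
Proof.
move=> e0 ij; have : grid e i = grid e j * expR (e * i%:R - e * j%:R).
  by rewrite /grid -mulrA -expRD addrC subrK.
have := expR_ge1Dx (e * i%:R - e * j%:R); have := grid_gt0 j e0.
by nra.
Qed.

Lemma slope_le (R : realType) (e : R) (y : R -> R) (i j : nat) :
  0 < e -> profile y -> (i < j)%N ->
  y (grid e j) - y (grid e i) <= slope e y i * (grid e j - grid e i).
Proof.
move=> e0 [conc _ _] ij; have i0 := grid_gt0 i e0.
have ii := grid_lt e0 (ltnSn i).
rewrite /slope -mulrAC ler_pdivlMr ?subr_gt0 //.
have [ji|ji] := leqP j i.+1.
  have -> : j = i.+1 by apply/eqP; rewrite eqn_leq ji.
  by [].
have := conc _ _ _ (ltW i0) ii (grid_lt e0 ji); lra.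
Qed.

Lemma slope_ge (R : realType) (e : R) (y : R -> R) (i j : nat) :
  0 < e -> profile y -> (i < j)%N ->
  slope e y j * (grid e j - grid e i) <= y (grid e j) - y (grid e i).
Proof.
move=> e0 [conc _ _] ij; have i0 := grid_gt0 i e0.
have jj := grid_lt e0 (ltnSn j).
rewrite /slope -mulrAC ler_pdivrMr ?subr_gt0 //.
by have := conc _ _ _ (ltW i0) (grid_lt e0 ij) jj; lra.
Qed.

Lemma slope_homo (R : realType) (e : R) (y : R -> R) (i j : nat) :
  0 < e -> profile y -> (i <= j)%N -> slope e y j <= slope e y i.
Proof.
move=> e0 py; rewrite leq_eqVlt => /predU1P[->//|ij].
have := le_trans (slope_ge e0 py ij) (slope_le e0 py ij).
by rewrite ler_pM2r // subr_gt0 grid_lt.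
Qed.

Lemma slope_ge0 (R : realType) (e : R) (y : R -> R) (i : nat) :
  0 < e -> profile y -> 0 <= slope e y i.
Proof.
move=> e0 [_ inc _]; have ii := grid_lt e0 (ltnSn i).
rewrite divr_ge0 // subr_ge0 ?(ltW ii) //.
by apply: inc; rewrite ltW // grid_gt0.
Qed.

(** Concavity on 0 and the two ends of the cell, with y 0 >= 0, gives the lower bound; y <= 1 and a
    nonnegative slope give the upper one. *)
Lemma intercept_itv (R : realType) (e : R) (y : R -> R) (i : nat) :
  0 < e -> profile y -> 0 <= intercept e y i <= 1.
Proof.
move=> e0 py; have s0 := slope_ge0 i e0 py; case: py => conc _ rng.
have ii := grid_lt e0 (ltnSn i); have i0 := grid_gt0 i e0.
have /andP[y0 y1] := rng _ (ltW i0).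
have /andP[y00 _] := rng 0 (lexx _); have cc := conc _ _ _ (lexx 0) i0 ii.
rewrite /intercept; apply/andP; split; last by nra.
have -> : y (grid e i) - grid e i * slope e y i =
  (y (grid e i) * grid e i.+1 - grid e i * y (grid e i.+1)) /
  (grid e i.+1 - grid e i).
  by rewrite /slope; field; rewrite subr_eq0 gt_eqF.
by rewrite divr_ge0 //; nra.
Qed.

(** Slope lost along the grid reappears, scaled by the position, as intercept gained; a bounded
    intercept thus limits the loss. *)
Lemma intercept_sub (R : realType) (e : R) (y : R -> R) (i j : nat) :
  0 < e -> profile y -> (i <= j)%N ->
  grid e i * (slope e y i - slope e y j) <= intercept e y j - intercept e y i.
Proof.
move=> e0 py; rewrite leq_eqVlt => /predU1P[->|ij]; first by rewrite !subrr mulr0.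
by have := slope_ge e0 py ij; rewrite /intercept; lra.
Qed.

Lemma potential_itv (R : realType) (e : R) (y : R -> R) (i : nat) :
  0 < e -> profile y -> 0 <= potential e y i <= e * i%:R + 1.
Proof.
move=> e0 py; have /andP[h0 h1] := intercept_itv i e0 py.
by rewrite /potential lerD2l h1 andbT addr_ge0 // mulr_ge0 // ltW.
Qed.

(** * Blocks on which a profile is close to its chord *)

(** Slope drop times width bounds the height of a concave function above its chord. *)
Definition flat_block (R : realType) (e : R) (y : R -> R) (a b : nat) : Prop :=
  (slope e y a - slope e y b) * (grid e b - grid e a) <= 2 * e.

(** Both terms of the potential are nondecreasing, so each grows by at most r. The first bounds the
    width by 2 r [grid e a], the second bounds the slope drop by r / [grid e a]; the product is 2
    r^2 = 2 e. *)
Lemma potential_flat (R : realType) (e r : R) (y : R -> R) (a b : nat) :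
  0 < e -> 0 <= r <= 2^-1 -> r ^+ 2 = e -> profile y -> (a <= b)%N ->
  potential e y b - potential e y a <= r -> flat_block e y a b.
Proof.
move=> e0 /andP[r0 r1] re py ab; rewrite /potential /flat_block => pot.
have ga := grid_gt0 a e0; have gb := grid_gt0 b e0.
have sab : 0 <= slope e y a - slope e y b by rewrite subr_ge0 slope_homo.
have isub := intercept_sub e0 py ab; have gsub := grid_sub e0 ab.
have eab : e * a%:R <= e * b%:R by rewrite ler_pM2l // ler_nat.
have i0 : 0 <= grid e a * (slope e y a - slope e y b) by rewrite mulr_ge0 // ltW.
have g1 : grid e b - grid e a <= grid e b * r.
  by apply: le_trans gsub _; rewrite ler_pM2l //; lra.
have g2 : grid e b <= 2 * grid e a by nra.
have g3 : grid e b - grid e a <= 2 * grid e a * r.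
  by apply: le_trans g1 _; rewrite ler_wpM2r.
apply: (@le_trans _ _ ((slope e y a - slope e y b) * (2 * grid e a * r))).
  by rewrite ler_wpM2l.
have : (grid e a * (slope e y a - slope e y b)) * r <= r * r.
  by rewrite ler_wpM2r //; lra.
by rewrite -expr2 re; lra.
Qed.

(** [y] exceeds its chord by at most 2 e, the chords differ by at most e, and [z] lies above its own
    chord. *)
Lemma flat_block_close (R : realType) (e : R) (y z : R -> R) (a i b : nat) :
  0 < e -> profile y -> profile z -> (a <= i <= b)%N -> flat_block e y a b ->
  y (grid e a) <= z (grid e a) + e -> y (grid e b) <= z (grid e b) + e ->
  y (grid e i) <= z (grid e i) + 3 * e.
Proof.
move=> e0 py pz /andP[]; rewrite leq_eqVlt => /predU1P[->|ai].
  by move=> _ _ ? _; lra.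
rewrite leq_eqVlt => /predU1P[->|ib]; first by move=> _ _ ?; lra.
rewrite /flat_block => flat ya yb.
have := slope_le e0 py ai; have := slope_ge e0 py (ltn_trans ai ib).
have [+ _ _] := pz => /(_ _ _ _ (ltW (grid_gt0 a e0)) (grid_lt e0 ai)).
move=> /(_ _ (grid_lt e0 ib)); have := grid_lt e0 ai; have := grid_lt e0 ib.
set ga := grid e a in ya *; set gi := grid e i; set gb := grid e b in yb flat *.
move: (slope e y a) (slope e y b) flat => sa sb flat.
move: (y ga) (y gi) (y gb) (z ga) (z gi) (z gb) ya yb.
move=> ya yi yb za zi zb hya hyb gib gai zc sgb sla.
have l0 : 0 < gb - ga by lra.
rewrite -(ler_pM2l l0).
have h1 : (gb - ga) * (yi - ya) <= (gb - ga) * (sa * (gi - ga)).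
  by rewrite ler_pM2l.
have h2 : (gi - ga) * ((sa - sb) * (gb - ga)) <= (gi - ga) * (2 * e).
  by rewrite ler_wpM2l //; lra.
have h3 : (gi - ga) * (sb * (gb - ga)) <= (gi - ga) * (yb - ya).
  by rewrite ler_wpM2l //; lra.
have h4 : (gb - gi) * ya <= (gb - gi) * (za + e) by rewrite ler_wpM2l //; lra.
have h5 : (gi - ga) * yb <= (gi - ga) * (zb + e) by rewrite ler_wpM2l //; lra.
have h6 : (gi - ga) * (2 * e) <= (gb - ga) * (2 * e).
  by rewrite ler_wpM2r //; lra.
lra.
Qed.

(** * Encoding a profile by finitely many blocks *)

Definition rounds_to (R : realType) (e : R) (n : nat) (x : R) : Prop :=
  e * n%:R <= x <= e * n%:R + e.

Definition encodes (R : realType) (e : R) (M N Q : nat) (y : R -> R)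
    (c : {ffun 'I_N.+1 -> ('I_M.+1 * 'I_M.+1) * ('I_Q.+1 * 'I_Q.+1)}) : Prop :=
  (forall i : 'I_M.+1, exists k, ((c k).1.1 <= i <= (c k).1.2)%N) /\
  (forall k, [/\ flat_block e y (c k).1.1 (c k).1.2,
     rounds_to e (c k).2.1 (y (grid e (c k).1.1)) &
     rounds_to e (c k).2.2 (y (grid e (c k).1.2))]).

Lemma encodes_close (R : realType) (e : R) (M N Q : nat) (y z : R -> R)
    (c : {ffun 'I_N.+1 -> ('I_M.+1 * 'I_M.+1) * ('I_Q.+1 * 'I_Q.+1)}) :
  0 < e -> profile y -> profile z -> encodes e y c -> encodes e z c ->
  forall i, (i <= M)%N -> y (grid e i) <= z (grid e i) + 3 * e.
Proof.
move=> e0 py pz [cov yc] [_ zc] i iM.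
have [k ki] := cov (Ordinal (iM : (i < M.+1)%N)).
have [flat /andP[_ ya] /andP[_ yb]] := yc k.
have [_ /andP[za _] /andP[zb _]] := zc k.
by apply: flat_block_close ki flat _ _ => //; lra.
Qed.

(** Blocks run from the first to the last index at which the potential, rounded down to a multiple
    of r, has a given level. The range of the potential leaves N + 1 levels. *)
Lemma encodes_exists (R : realType) (e r : R) (M N Q : nat) (y : R -> R) :
  0 < e -> 0 < r <= 2^-1 -> r ^+ 2 = e -> profile y ->
  e * M%:R + 1 < r * N.+1%:R -> 1 < e * Q.+1%:R ->
  exists c : {ffun 'I_N.+1 -> ('I_M.+1 * 'I_M.+1) * ('I_Q.+1 * 'I_Q.+1)},
    encodes e y c.
Proof.
move=> e0 /andP[r0 r1] re py hN hQ.
have r01 : 0 <= r <= 2^-1 by rewrite ltW.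
pose level i := Num.truncn (potential e y i / r).
have levelP i : r * (level i)%:R <= potential e y i < r * (level i)%:R + r.
  have /andP[p0 _] := potential_itv i e0 py.
  have /truncn_itv /andP[] : 0 <= potential e y i / r by rewrite divr_ge0 // ltW.
  by rewrite -/(level i) -natr1 ler_pdivlMr // ltr_pdivrMr //; lra.
have levelN (i : 'I_M.+1) : (level i < N.+1)%N.
  have /andP[l0 _] := levelP i; have /andP[_ p1] := potential_itv i e0 py.
  have iM : e * i%:R <= e * M%:R by rewrite ler_pM2l // ler_nat -ltnS.
  by rewrite -(ltr_nat R) -(ltr_pM2l r0); lra.
have roundP (i : 'I_M.+1) : exists n : 'I_Q.+1, rounds_to e n (y (grid e i)).
  have [_ _ /(_ _ (ltW (grid_gt0 i e0)))/andP[y0 y1]] := py.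
  have /truncn_itv /andP[] : 0 <= y (grid e i) / e by rewrite divr_ge0 // ltW.
  set n := Num.truncn _; rewrite ler_pdivlMr // ltr_pdivrMr // => n0 n1.
  have nQ : (n < Q.+1)%N by rewrite -(ltr_nat R) -(ltr_pM2l e0); lra.
  by exists (Ordinal nQ); rewrite /rounds_to /= -natr1 in n1 *; lra.
have [f fP] := choice roundP.
have block (k : 'I_N.+1) : exists ab : 'I_M.+1 * 'I_M.+1,
    flat_block e y ab.1 ab.2 /\
    (forall i : 'I_M.+1, level i = k -> (ab.1 <= i <= ab.2)%N).
  have [[i0 i0k]|none] := pselect (exists i0 : 'I_M.+1, level i0 == k); last first.
    (* A level that is never attained gets a one-point block, trivially flat. *)
    exists (ord0, ord0); split; last by move=> i ik; case: none; exists i; apply/eqP.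
    by rewrite /flat_block subrr mul0r mulr_ge0 // ltW.
  exists ([arg min_(i < i0 | level i == k) i]%N,
          [arg max_(i > i0 | level i == k) i]%N) => /=.
  case: arg_minnP => // a /eqP ak amin; case: arg_maxnP => // b /eqP bk bmax.
  split; last by move=> i /eqP ik; apply/andP; split; [exact: amin|exact: bmax].
  apply: (potential_flat e0 r01 re py); first by apply: amin; rewrite bk.
  by have := levelP a; have := levelP b; rewrite ak bk; lra.
have [g gP] := choice block.
exists [ffun k => (g k, (f (g k).1, f (g k).2))]; split.
  move=> i; exists (Ordinal (levelN i)); rewrite ffunE /=.
  by apply: (gP _).2.
by move=> k; rewrite ffunE /=; split=> //; case: (gP k).
Qed.

(** * From grid values to the Levy distance, and from codes to covers *)

(** Take the last grid level p i below G v. The quantile of [G] there is at most v, so that of [F]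
    is below v + 4 e and F (v + 4 e) >= p i; the next level is at most e higher. Below the first
    level and above the last one, only e is lost. *)
Lemma grid_levy (R : realType) (F G : R -> R) (e : R) (M : nat) :
  0 < e -> is_cdf F -> supported01 F -> is_cdf G -> supported01 G ->
  1 <= e * grid e M ->
  (forall i, (i <= M)%N ->
    tail_quantile F (grid e i) <= tail_quantile G (grid e i) + 3 * e) ->
  forall v, G v <= F (v + 4 * e) + e.
Proof.
move=> e0 Fc [F0 F1] Gc [G0 G1] hM close v.
have Fm : {homo F : x y / x <= y} by case: Fc.
have /andP[Fv0 _] := is_cdf_itv (v + 4 * e) Fc.
have /andP[Gv0 Gv1] := is_cdf_itv v Gc.
have [v0|v0] := ltP v 0; first by rewrite G0 //; lra.
have [v1|v1] := leP 1 v; first by have := Fm 1 (v + 4 * e); rewrite F1; lra.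
pose p i := 1 - (1 + grid e i)^-1.
have g0 i := grid_gt0 i e0.
have ple1 i : p i <= 1 by rewrite gerBl invr_ge0 addr_ge0 // ltW.
have [Gp|pG] := ltP (G v) (p 0%N).
  have : p 0%N <= e; last by lra.
  rewrite /p /grid mulr0 expR0 mulr1.
  have -> : 1 - (1 + e)^-1 = e / (1 + e) by field; rewrite gt_eqF //; lra.
  by rewrite ler_pdivrMr; nra.
pose P i := (i <= M)%N && (p i <= G v).
have exP : exists i, P i by exists 0%N; rewrite /P pG.
have PM i : P i -> (i <= M)%N by case/andP.
have [i /andP[iM pi] imax] := ex_maxnP exP PM.
have qG : tail_quantile G (grid e i) <= v by apply: quantile_le => //; lra.
(* The fourth e makes the inequality strict, as [quantile_lt] requires. *)
have qF : tail_quantile F (grid e i) < v + 4 * e by have := close i iM; lra.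
have [w [w01 pw wv]] := quantile_lt F1 (ple1 i) qF.
have pF : p i <= F (v + 4 * e) by apply: le_trans pw (Fm _ _ (ltW wv)).
suff : G v <= p i + e by lra.
have [iM'|Mi] := ltnP i M; last first.
  have -> : i = M by apply/eqP; rewrite eqn_leq iM.
  have : (1 + grid e M)^-1 <= e; last by rewrite /p; lra.
  by have := g0 M; rewrite -[leLHS]mul1r ler_pdivrMr; nra.
have : G v < p i.+1.
  rewrite ltNge; apply/negP => pi1; have := imax i.+1; rewrite /P iM' pi1.
  by rewrite ltnn => /(_ erefl).
suff : p i.+1 <= p i + e by lra.
have gs := grid_sub e0 (leqnSn i); have gi := g0 i; have gi1 := g0 i.+1.
have gs' : grid e i.+1 - grid e i <= e * grid e i.+1.
  by move: gs; rewrite -natr1; lra.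
have -> : p i.+1 = p i +
    (grid e i.+1 - grid e i) / ((1 + grid e i) * (1 + grid e i.+1)).
  by rewrite /p; field; apply/andP; split; rewrite gt_eqF //; lra.
have eg : 0 < e * grid e i by rewrite mulr_gt0.
have egg : 0 < e * (grid e i * grid e i.+1) by apply: mulr_gt0 => //; exact: mulr_gt0.
have den : 0 < (1 + grid e i) * (1 + grid e i.+1) by apply: mulr_gt0; lra.
by rewrite lerD2l ler_pdivrMr //; lra.
Qed.

(** The cover consists of one member of [C] per realized code. *)
Lemma describable_of_code (R : realType) (T : finType) (C : (R -> R) -> Prop)
    (enc : (R -> R) -> T -> Prop) (b : nat) (eps : R) :
  (#|T| <= 2 ^ b)%N -> (forall F, C F -> is_cdf F) ->
  (forall F, C F -> exists c, enc F c) ->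
  (forall F G c, C F -> C G -> enc F c -> enc G c -> levy F G <= eps) ->
  describable C b eps.
Proof.
move=> Tb Ccdf encE encP.
have rep (c : T) : exists F', (exists F, C F /\ enc F c) -> C F' /\ enc F' c.
  have [[F hF]|none] := pselect (exists F, C F /\ enc F c); first by exists F.
  (* A placeholder for codes without a member of [C]; the filter below drops them. *)
  by exists id => /none.
have [g gP] := choice rep.
exists [seq g c | c <- enum T & `[< exists F, C F /\ enc F c >]].
split; [|split].
- rewrite size_map (leq_trans _ Tb) // cardT size_filter.
  exact: count_size.
- by move=> F' /mapP[c]; rewrite mem_filter => /andP[/asboolP /gP [? _] _] ->;
    exact: Ccdf.
- move=> F CF; have [c Fc] := encE F CF.
  have ex : exists F, C F /\ enc F c by exists F.
  exists (g c); last by have [? ?] := gP c ex; exact: encP CF _ Fc _.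
  by apply: map_f; rewrite mem_filter mem_enum andbT; apply/asboolP.
Qed.

Lemma describable_upper (R : realType) (e r : R) (M N Q B : nat) :
  0 < e -> 0 < r <= 2^-1 -> r ^+ 2 = e ->
  e * M%:R + 1 < r * N.+1%:R -> 1 < e * Q.+1%:R -> 1 <= e * grid e M ->
  (M.+1 * M.+1 * (Q.+1 * Q.+1) <= 2 ^ B)%N ->
  describable (@regular01 R) (N.+1 * B)%N (4 * e).
Proof.
move=> e0 r01 re hN hQ hM hB.
pose T := {ffun 'I_N.+1 -> ('I_M.+1 * 'I_M.+1) * ('I_Q.+1 * 'I_Q.+1)}.
apply: (@describable_of_code R T _ (fun F c => encodes e (tail_quantile F) c)).
- rewrite card_ffun !card_prod !card_ord [(_ * B)%N]mulnC expnM.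
  by rewrite leq_exp2r.
- by move=> F [].
- by move=> F /tail_quantile_profile pF; exact: encodes_exists pF hN hQ.
move=> F G c FR GR Fc Gc.
have pF := tail_quantile_profile FR; have pG := tail_quantile_profile GR.
have [Fcdf [Fs _]] := FR; have [Gcdf [Gs _]] := GR.
apply: levy_le; first by lra.
move=> v; split.
  have := grid_levy e0 Gcdf Gs Fcdf Fs hM (encodes_close e0 pG pF Gc Fc).
  by move=> /(_ (v - 4 * e)); rewrite subrK; lra.
have := grid_levy e0 Fcdf Fs Gcdf Gs hM (encodes_close e0 pF pG Fc Gc).
by move=> /(_ v); lra.
Qed.

(** * Choice of the parameters *)

Lemma expR_half_le2 (R : realType) : expR (2^-1 : R) <= 2.
Proof.
have := expR_ge1Dx (- 2^-1 : R); rewrite expRN.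
have h := expR_gt0 (2^-1 : R).
by rewrite -[leRHS]mul1r ler_pdivlMr //; lra.
Qed.

Lemma upper_bound (R : realType) (eps : R) : 0 < eps -> eps < 4^-1 ->
  exists b : nat, b%:R <= 840 * (Num.sqrt eps)^-1 * ln (eps^-1) ^+ 2 /\
    describable (@regular01 R) b eps.
Proof.
move=> eps0 eps1; pose e := eps / 4; pose r := Num.sqrt eps / 2.
pose L := ln e^-1.
have e0 : 0 < e by rewrite divr_gt0.
have e1 : e <= 16^-1 by rewrite /e; lra.
have s0 : 0 < Num.sqrt eps by rewrite sqrtr_gt0.
have ss : Num.sqrt eps ^+ 2 = eps by rewrite sqr_sqrtr // ltW.
have r0 : 0 < r by rewrite divr_gt0.
have re : r ^+ 2 = e by rewrite /r /e expr_div_n ss; lra.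
have r1 : r <= 2^-1 by nra.
have expL : expR L = e^-1 by rewrite lnK // posrE invr_gt0.
have ei0 : 0 < e^-1 by rewrite invr_gt0.
have ei16 : 16 <= e^-1 by rewrite -[16]invrK lef_pV2 ?posrE // invr_gt0.
have L1 : 1 <= L.
  rewrite -ler_expR expL.
  have -> : 1 = 2^-1 + 2^-1 :> R by lra.
  rewrite expRD; have := expR_half_le2 R; have := expR_gt0 (2^-1 : R).
  by nra.
have Lei : L <= e^-1 by apply: ltW; exact: ln_sublinear.
(* As eps < 1 / 4, 1 / e = 4 / eps is at most 1 / eps^2. *)
have Leps : L <= 2 * ln eps^-1.
  have ei : 0 < eps^-1 by rewrite invr_gt0.
  have -> : 2 * ln eps^-1 = ln (eps^-1 * eps^-1).
    by rewrite lnM ?posrE //; lra.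
  rewrite /L ler_ln ?posrE ?mulr_gt0 //.
  have -> : e^-1 = 4 * eps^-1 by rewrite /e; field; rewrite gt_eqF.
  rewrite ler_pM2r //.
  by rewrite -[4]invrK lef_pV2 ?posrE ?invr_gt0 // ltW.
have ee : e * e^-1 = 1 by rewrite divff // gt_eqF.
(* e M exceeds 2 L, so the grid reaches e exp(2 L) = 1 / e. *)
pose M := (Num.truncn (2 * L / e)).+1; pose Q := Num.truncn e^-1.
pose N := Num.truncn ((e * M%:R + 1) / r).
pose B := (Num.truncn (20 * L)).+1.
have /andP[M0 M1] : 2 * L / e < M%:R <= 2 * L / e + 1.
  have /truncn_itv/andP[a b] : 0 <= 2 * L / e by rewrite divr_ge0 ?ltW //; lra.
  by rewrite /M b -natr1 lerD2r.
have /andP[Q0 Q1] : e^-1 < Q.+1%:R <= e^-1 + 1.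
  have /truncn_itv/andP[a b] := ltW ei0.
  by rewrite /Q b -natr1 lerD2r.
have eM0 : 0 <= e * M%:R by rewrite mulr_ge0 // ltW.
have /andP[N0 N1] : (e * M%:R + 1) / r < N.+1%:R <= (e * M%:R + 1) / r + 1.
  have /truncn_itv/andP[a b] : 0 <= (e * M%:R + 1) / r.
    by rewrite divr_ge0 ?ltW //; lra.
  by rewrite /N b -natr1 lerD2r.
have /andP[B0 B1] : 20 * L < B%:R <= 20 * L + 1.
  have /truncn_itv/andP[a b] : 0 <= 20 * L by lra.
  by rewrite /B b -natr1 lerD2r.
have eMlow : 2 * L < e * M%:R by move: M0; rewrite ltr_pdivrMr // [_ * e]mulrC.
have eMup : e * M%:R <= 2 * L + e.
  have : e * M%:R <= e * (2 * L / e + 1) by rewrite ler_pM2l.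
  have -> // : e * (2 * L / e + 1) = 2 * L + e by field; rewrite gt_eqF.
exists (N.+1 * B)%N; split; last first.
  have -> : eps = 4 * e by rewrite /e; field.
  apply: (describable_upper (r := r) (M := M) (Q := Q)) => //.
  - by rewrite r0.
  - by move: N0; rewrite ltr_pdivrMr // [_ * r]mulrC.
  - by have := ltr_pM2l e0 e^-1 Q.+1%:R; rewrite Q0 ee => ->.
  - have : expR (2 * L) <= expR (e * M%:R) by rewrite ler_expR ltW.
    rewrite mulrDl mul1r expRD expL /grid => h.
    have : e * (e * (e^-1 * e^-1)) <= e * (e * expR (e * M%:R)).
      by rewrite !ler_pM2l.
    by rewrite [e * (e^-1 * _)]mulrA ee mul1r ee.
  - rewrite -(ler_nat R) !natrM natrX.
    (* One block has at most e^-(3 + 3 + 2 + 2) = exp(10 L) codes, and 2 >= exp(1 / 2) turns this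
       into 20 L bits. *)
    have MM : M.+1%:R <= e^-1 ^+ 3.
      have : 16 * 16 <= e^-1 * e^-1 by apply: ler_pM.
      have : 16 * (e^-1 * e^-1) <= e^-1 ^+ 3.
        by rewrite exprS expr2 ler_pM2r // mulr_gt0.
      have : L * e^-1 <= e^-1 * e^-1 by rewrite ler_pM2r.
      by rewrite -natr1; lra.
    have QQ : Q.+1%:R <= e^-1 ^+ 2.
      have : 16 * e^-1 <= e^-1 ^+ 2 by rewrite expr2 ler_pM2r.
      by lra.
    have E10 : expR (10 * L) = e^-1 ^+ 10.
      by rewrite -expL -expRM_natl.
    apply: (@le_trans _ _ (expR (10 * L))).
      rewrite E10 -[10%N]/(3 + 3 + (2 + 2))%N !exprD.
      by rewrite !ler_pM ?mulr_ge0.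
    apply: (@le_trans _ _ (expR (2^-1) ^+ B)).
      by rewrite -expRM_natl ler_expR; lra.
    by rewrite lerXn2r ?nnegrE ?expR_ge0 ?expR_half_le2.
rewrite natrM.
have ir2 : 2 <= r^-1 by rewrite -[2]invrK lef_pV2 ?posrE.
have N5 : N.+1%:R <= 5 * L * r^-1.
  have : (e * M%:R + 1) / r <= 4 * L * r^-1 by rewrite ler_pM2r ?invr_gt0 //; lra.
  have : r^-1 <= L * r^-1 by rewrite ler_peMl // invr_ge0 ltW.
  by lra.
have B21 : B%:R <= 21 * L by lra.
(* The constant 840 is 5 * 21, times 2 from 1 / r, times 4 from L^2. *)
apply: (@le_trans _ _ (5 * L * r^-1 * (21 * L))); first by apply: ler_pM.
have -> : r^-1 = 2 * (Num.sqrt eps)^-1 by rewrite /r; field; rewrite gt_eqF.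
have is0 : 0 <= (Num.sqrt eps)^-1 by rewrite invr_ge0 ltW.
have LL : L * L <= 2 * ln eps^-1 * (2 * ln eps^-1) by apply: ler_pM => //; lra.
have : (Num.sqrt eps)^-1 * (L * L) <=
  (Num.sqrt eps)^-1 * (2 * ln eps^-1 * (2 * ln eps^-1)) by rewrite ler_wpM2l.
by lra.
Qed.

Theorem theorem1 (R : realType) :
  (* upper bound: b = O~(eps^{-1/2}) bits suffice for all small eps *)
  (exists (c : R) (k : nat) (eps0 : R), 0 < c /\ 0 < eps0 /\
     forall eps : R, 0 < eps -> eps < eps0 ->
       exists b : nat,
         b%:R <= c * (Num.sqrt eps)^-1 * (ln (eps^-1)) ^+ k /\
         describable (@regular01 R) b eps) /\
  (* lower bound: b = Omega(eps^{-1/2}) bits are necessary for all small eps *)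
  (exists (c : R) (eps0 : R), 0 < c /\ 0 < eps0 /\
     forall (eps : R) (b : nat), 0 < eps -> eps < eps0 ->
       describable (@regular01 R) b eps ->
       c * (Num.sqrt eps)^-1 <= b%:R).
Proof.
split.
  exists 840, 2%N, 4^-1; split; first by rewrite ltr0n.
  split; first by rewrite invr_gt0.
  by move=> eps eps0 eps1; have [b hb] := upper_bound eps0 eps1; exists b.
exists 48^-1, (48^-1 ^+ 2); split; first by rewrite invr_gt0.
split; first by rewrite exprn_gt0 // invr_gt0.
by move=> eps b eps0 eps1 desc; exact: lower_bound eps0 eps1 desc.
Qed.
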